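(* Let $\mathbb{K}$ be a field with more than $2$ elements, let $U$ and $V$ be finite-dimensional vector spaces over $\mathbb{K}$, and let $\mathcal{S}$ be an affine subspace of $\mathcal{L}(U,V)$ with $\operatorname{codim} \mathcal{S} \leq \dim V-1$. Then, every range-compatible affine map $F : \mathcal{S} \rightarrow V$ is local.
   Context: $\mathcal{L}(U,V)$ is the vector space of all linear maps from $U$ to $V$. Affine subspaces are non-empty; the codimension of an affine subspace $\mathcal{S}$ of $\mathcal{L}(U,V)$ is $\dim \mathcal{L}(U,V)-\dim \mathcal{S}$. For a subset $\mathcal{S}$ of $\mathcal{L}(U,V)$, a map $F : \mathcal{S} \rightarrow V$ is called range-compatible when $F(s) \in \operatorname{Im} s$ for all $s \in \mathcal{S}$; it is called local when there exists $x \in U$ such that $F(s)=s(x)$ for all $s \in \mathcal{S}$. *)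

(* Defs.v *)
From HB Require Import structures.
From mathcomp Require Import all_boot all_order all_algebra.
Set Implicit Arguments.
Unset Strict Implicit.
Unset Printing Implicit Defensive.
Import Order.TTheory GRing.Theory Num.Theory.
Local Open Scope ring_scope.

(* K may be infinite, so its cardinality is bounded below by exhibiting       *)
(* a duplicate-free sequence.                                                 *)
Definition more_than_two_elements (K : fieldType) : Prop :=
  exists s : seq K, uniq s /\ (2 < size s)%N.

(* The (nonempty) affine subspace aff_pt + aff_dir. The base point is not     *)
(* determined by the underlying set, but the direction is: see aff_dir_uniq.  *)
Record affspace (K : fieldType) (W : vectType K) := AffSpace {
  aff_pt : W;
  aff_dir : {vspace W}
}.

Definition pred_of_affspace (K : fieldType) (W : vectType K)
    (S : affspace W) : {pred W} :=
  fun w => w - aff_pt S \in aff_dir S.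

Coercion pred_of_affspace : affspace >-> pred_sort.

Lemma aff_dir_uniq (K : fieldType) (W : vectType K) (S T : affspace W) :
  S =i T -> aff_dir S = aff_dir T.
Proof.
move=> eqST; have memE (A : affspace W) w :
  (w \in A) = (w - aff_pt A \in aff_dir A) by [].
have pT : aff_pt S - aff_pt T \in aff_dir T.
  by rewrite -memE -eqST memE subrr mem0v.
apply/vspaceP => v; have := eqST (aff_pt S + v).
by rewrite !memE addrAC subrr add0r => ->; rewrite addrAC rpredDl.
Qed.

Definition codim (K : fieldType) (W : vectType K) (S : affspace W) : int :=
  (\dim {:W})%:Z - (\dim (aff_dir S))%:Z.

(* A map defined on a subset S of W is represented by a function on the whole *)
(* of W; the predicates below only depend on its values on S.                 *)
Definition affine_map (K : fieldType) (W V : vectType K)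
    (S : affspace W) (F : W -> V) : Prop :=
  exists f : {linear subvs_of (aff_dir S) -> V},
    {in S, forall s, forall d : subvs_of (aff_dir S),
      F (s + vsval d) = F s + f d}.

Definition range_compatible (K : fieldType) (U V : vectType K)
    (S : {pred 'Hom(U, V)}) (F : 'Hom(U, V) -> V) : Prop :=
  {in S, forall s : 'Hom(U, V), F s \in limg s}.

Definition local_map (K : fieldType) (U V : vectType K)
    (S : {pred 'Hom(U, V)}) (F : 'Hom(U, V) -> V) : Prop :=
  exists x : U, {in S, forall s : 'Hom(U, V), F s = s x}.

(* Main.v *)
(* In matrix form S becomes a parametrized affine family d |-> S(d) of p x n  *)
(* matrices acting on row vectors, and F a map d |-> F(d) with F(d) in the    *)
(* row space of S(d). This form passes to quotients of V without having to    *)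
(* check that F descends, so we induct on n = dim V. For a nonzero y in V,    *)
(* the codimension bound survives modulo y unless the codimension equals      *)
(* n - 1 and the direction of S contains all maps with range in K y. As       *)
(* |K| > 2, one finds independent z1, z2 such that neither z1, z2 nor         *)
(* z1 + z2 is exceptional, so that F agrees with the local maps of x1, x2, x3 *)
(* up to K z1, K z2, K (z1 + z2) respectively. Then S(x2 - x1) and S(x3 - x1) *)
(* satisfy so many linear relations that, unless F is local, these relations  *)
(* already define S; hence S contains a rank one map s with range spanned by  *)
(* z1 + b z2, b <> 0, while F(s) - s(x1) = z1, which is absurd.               *)
Require Import Defs.
From HB Require Import structures.
From mathcomp Require Import all_boot all_order all_algebra.
From mathcomp Require Import zify ring.
Import passmx.
Import Order.TTheory GRing.Theory Num.Theory.
Local Open Scope ring_scope.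
Set Implicit Arguments.
Unset Strict Implicit.

Lemma lin_mx_full (K : fieldType) (m n p q : nat)
    (g : {linear 'M[K]_(m, n) -> 'M[K]_(p, q)}) :
  (forall M, exists N, g N = M) -> row_full (lin_mx g).
Proof.
move=> surj_g; rewrite -sub1mx; apply/row_subP => i.
have [N gN] := surj_g (vec_mx (row i 1%:M)).
by rewrite -[row i _]vec_mxK -gN -mul_vec_lin submxMl.
Qed.

(* Affine families are given by matrices with vectorized rows: S(d) is        *)
(* s0 + vec_mx (d *m A), so the codimension of S is p * n - \rank A.          *)
Section Family.

Variables (K : fieldType) (p n m : nat).
Variables (A : 'M[K]_(m, p * n)) (s0 : 'M[K]_(p, n)).

(** A dimension count. Since [X] has independent rows, [s |-> X *m s] is onto, so the solutions of
    [X *m s] in [T] form a space of codimension at least n - 1. The family lies in that space and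
    has codimension at most n - 1, so it fills it. *)
Lemma family_fills_preimage (k t : nat) (X : 'M[K]_(k, p)) (T : 'M[K]_(t, k * n)) :
  row_free X ->
  (p * n < \rank A + n)%N -> (\rank T + n <= (k * n).+1)%N ->
  (forall d, mxvec (X *m (s0 + vec_mx (d *m A))) <= T)%MS ->
  forall s, (mxvec (X *m s) <= T)%MS ->
  exists d, s0 + vec_mx (d *m A) = s.
Proof.
move=> /row_freeP[X' XX'] codimA rkT XS s Xs.
have L_full : row_full (lin_mulmx X : 'M_(p * n, k * n)).
  by apply: lin_mx_full => M; exists (X' *m M); rewrite /= mulmxA XX' mul1mx.
set L := lin_mulmx X in L_full.
pose P := kermx (L *m cokermx T).
have memP u : (mxvec (X *m u) <= T)%MS = (mxvec u <= P)%MS.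
  by rewrite /P sub_kermx mulmxA mul_vec_lin submxE.
have s0P : (mxvec s0 <= P)%MS.
  by rewrite -memP; have := XS 0; rewrite mul0mx linear0 addr0.
have AP : (A <= P)%MS.
  apply/row_subP => i; have := XS (delta_mx 0 i); rewrite memP linearD /= vec_mxK.
  rewrite -rowE => H; rewrite -(addKr (mxvec s0) (row i A)).
  by rewrite addmx_sub ?eqmx_opp.
have rkP : (\rank P <= \rank A)%N.
  rewrite mxrank_ker -mxrank_tr trmx_mul mxrankMfree ?mxrank_tr.
    rewrite mxrank_coker.
    have := rank_leq_col T; have := rank_leq_col A; have := rank_leq_col L.
    have := rank_leq_row L; move: L_full; rewrite /row_full => /eqP ->; lia.
  by rewrite /row_free mxrank_tr.
have PA : (P <= A)%MS by rewrite -(mxrank_leqif_sup AP).2 eqn_leq mxrankS.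
have /submxP[d dA] : (mxvec (s - s0) <= A)%MS.
  by apply: submx_trans PA; rewrite linearB addmx_sub ?eqmx_opp // -memP.
by exists d; rewrite -dA mxvecK addrC subrK.
Qed.

(** The column base of [cokermx y] serves as the projection modulo y. Unlike [cokermx y] itself, it
    has only [\rank (cokermx y)] columns, so for nonzero y the induction on n can proceed. *)
Lemma mul_col_base_coker_eq0 (y v : 'rV[K]_n) :
  v *m col_base (cokermx y) = 0 <-> exists c, v = c *: y.
Proof.
have base_inj : injective (mulmx^~ (row_base (cokermx y)) : 'rV__ -> _).
  exact/row_free_inj/row_base_free.
have -> : v *m col_base (cokermx y) = 0 <-> v *m cokermx y = 0.
  split=> [vQ|vy]; first by rewrite -(mulmx_base (cokermx y)) mulmxA vQ mul0mx.
  by apply: base_inj; rewrite /= mul0mx -mulmxA mulmx_base.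
split=> [vy|[c ->]]; last by rewrite -scalemxAl mulmx_coker scaler0.
by apply/sub_rVP; rewrite submxE vy.
Qed.

(* The exceptional vectors y, modulo which the bound codim < dim V is lost;   *)
(* the second condition says that the direction of S contains every map with  *)
(* range in the line spanned by y.                                            *)
Definition tight (y : 'rV[K]_n) : bool :=
  (\rank A + n == (p * n).+1)%N &&
  [forall i, (mxvec (delta_mx i 0 *m y : 'M_(p, n)) <= A)%MS].

Lemma tightB u v : tight u -> tight v -> tight (u - v).
Proof.
move=> /andP[rkA /forallP uA] /andP[_ /forallP vA].
rewrite /tight rkA; apply/forallP => i.
by rewrite mulmxBr linearB addmx_sub ?eqmx_opp ?uA ?vA.
Qed.

Lemma tightZ a u : a != 0 -> tight (a *: u) = tight u.
Proof.
move=> a0; rewrite /tight; congr (_ && _); apply: eq_forallb => i.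
by rewrite -scalemxAr linearZ eqmx_scale.
Qed.

(** Otherwise the direction would contain every elementary matrix, and its codimension would be 0
    instead of n - 1 > 0. *)
Lemma not_tight_unit : (1 < n)%N -> exists j, ~~ tight (delta_mx 0 j).
Proof.
move=> n1; apply/existsP; rewrite -negb_forall; apply/negP => /forallP all_tight.
have /andP[/eqP rkA _] := all_tight (Ordinal n1).
suff /eqP : row_full A by lia.
rewrite -sub1mx; apply/row_subP => k.
rewrite -[row k _]vec_mxK [vec_mx _]matrix_sum_delta !linear_sum summx_sub //= => i _.
rewrite linear_sum summx_sub //= => j _; rewrite linearZ scalemx_sub //.
have /andP[_ /forallP/(_ i)] := all_tight j.
by rewrite mul_delta_mx.
Qed.

(** The kernel of [s |-> s *m Q] consists of the matrices with rows in K y and has dimension p. By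
    rank-nullity the codimension does not grow, while n drops by 1. So the bound can fail only if
    the codimension is n - 1 and does not decrease, that is, if the direction contains the whole
    kernel. *)
Lemma codim_quotient (y : 'rV[K]_n) (Q := col_base (cokermx y)) :
  y != 0 -> (p * n < \rank A + n)%N -> ~~ tight y ->
  (p * \rank (cokermx y) < \rank (A *m lin_mulmxr Q) + \rank (cokermx y))%N.
Proof.
move=> y0 codimA; apply: contraR; rewrite -leqNgt => codimQ.
have rky : \rank y = 1%N.
  by apply/eqP; rewrite eqn_leq rank_leq_row lt0n mxrank_eq0.
have n0 : (0 < n)%N by rewrite -rky rank_leq_col.
move: codimQ; set L := lin_mulmxr Q => codimQ.
have rkL : \rank L = (p * \rank (cokermx y))%N.
  apply/eqP; apply: lin_mx_full => M.
  have [Q' Q'Q] := row_fullP (col_base_full (cokermx y)).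
  by exists (M *m Q'); rewrite /= -mulmxA Q'Q mulmx1.
have := mxrank_mul_ker A L; have := mxrank_ker L.
have := mxrankS (capmxSr A (kermx L)); rewrite rkL => rk_cap rk_ker rk_mul.
have rkQ : (n = (\rank (cokermx y)).+1)%N by rewrite mxrank_coker rky; lia.
have pn : (p * n = p * \rank (cokermx y) + p)%N by rewrite {1}rkQ mulnS addnC.
rewrite /tight; apply/andP; split; first by apply/eqP; lia.
have kerA : (kermx L <= A)%MS.
  have /mxrank_leqif_sup[_] := capmxSr A (kermx L).
  have -> : \rank (A :&: kermx L)%MS == \rank (kermx L) by apply/eqP; lia.
  by move/esym/submx_trans; apply; apply: capmxSl.
apply/forallP => i; apply: submx_trans kerA; rewrite sub_kermx mul_vec_lin /=.
have [_ yQ] := mul_col_base_coker_eq0 y y.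
by rewrite -mulmxA yQ ?mulmx0 ?linear0 //; exists 1; rewrite scale1r.
Qed.
End Family.

(** If y1 is not tight, the line of vectors y2 + l y1 has at most one tight point, since the
    difference of two such points is a nonzero multiple of y1. Three scalars thus give two non-tight
    points, which serve as z2 and z1 + z2; then z1 is a multiple of y1. *)
Lemma exists_pair_not_tight (K : fieldType) (p n m : nat) (A : 'M[K]_(m, p * n)) :
  more_than_two_elements K -> (1 < n)%N ->
  exists z1 z2 : 'rV[K]_n,
    [/\ forall a b, a *: z1 + b *: z2 = 0 -> a = 0 /\ b = 0,
        ~~ tight A z1, ~~ tight A z2 & ~~ tight A (z1 + z2)].
Proof.
move=> [s [s_uniq s_size]] n1.
have [j tj] := not_tight_unit A n1.
have [k kj] : exists k : 'I_n, k != j.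
  have n0 : (0 < n)%N by apply: ltnW.
  have [->|?] := eqVneq j (Ordinal n0); first by exists (Ordinal n1).
  by exists (Ordinal n0); rewrite eq_sym.
set y1 : 'rV[K]_n := delta_mx 0 j in tj; set y2 : 'rV[K]_n := delta_mx 0 k.
have free a b : a *: y1 + b *: y2 = 0 -> a = 0 /\ b = 0.
  move=> ab0; split; [move/rowP/(_ j): ab0 | move/rowP/(_ k): ab0]; rewrite !mxE !eqxx /=.
    by rewrite eq_sym (negbTE kj) mulr0 addr0 mulr1.
  by rewrite (negbTE kj) mulr0 add0r mulr1.
have tight_line l l' : l != l' -> tight A (y2 + l *: y1) ->
    ~~ tight A (y2 + l' *: y1).
  move=> ll' tl; apply: contra tj => tl'.
  rewrite -(@tightZ _ _ _ _ A (l - l')) ?subr_eq0 //.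
  have -> : (l - l') *: y1 = y2 + l *: y1 - (y2 + l' *: y1).
    by rewrite [y2 + _]addrC addrKA scalerBl.
  exact: tightB.
have [l [l' [ll' tl tl']]] : exists l l', [/\ l != l',
    ~~ tight A (y2 + l *: y1) & ~~ tight A (y2 + l' *: y1)].
  case: s s_uniq s_size => [|a [|b [|c s]]] //= /andP[].
  rewrite !inE !negb_or => /and3P[ab ac _] /andP[/andP[bc _] _] _.
  have [ta|ta] := boolP (tight A (y2 + a *: y1)).
    by exists b, c; split=> //; apply: tight_line ta.
  have [tb|tb] := boolP (tight A (y2 + b *: y1)).
    by exists a, c; split=> //; apply: tight_line tb.
  by exists a, b.
exists ((l' - l) *: y1), (y2 + l *: y1); split=> //.
- move=> a b ab0; have [] := free (a * (l' - l) + b * l) b.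
    by rewrite -ab0 scalerDl scalerDr !scalerA -!addrA; congr (_ + _); rewrite addrC.
  move=> /eqP + b0; rewrite b0 mul0r addr0 mulf_eq0 subr_eq0 [l' == l]eq_sym.
  by rewrite (negbTE ll') orbF => /eqP.
- by rewrite tightZ // subr_eq0 eq_sym.
- by rewrite addrCA -scalerDl subrK.
Qed.

Lemma exists_neq01 (K : fieldType) :
  more_than_two_elements K -> exists b : K, b != 0 /\ b != 1.
Proof.
move=> [s [s_uniq s_size]].
have /hasP[b _] : has [pred b : K | (b != 0) && (b != 1)] s.
  apply: contraT => /hasPn s01.
  suff: (size s <= size [:: (0 : K)%R; 1%R])%N by rewrite leqNgt s_size.
  apply: uniq_leq_size => // b /s01; rewrite !inE /=.
  by case: (b == 0); case: (b == 1).
by move=> /andP[b0 b1]; exists b.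
Qed.

(** Here the family consists of all columns. It contains 0, where F vanishes, so F factors through a
    linear form on columns, which is a product with a fixed row. *)
Lemma range_compatible_family_column (K : fieldType) (p m : nat)
    (A : 'M[K]_(m, p * 1)) (f : 'M[K]_(m, 1)) (s0 : 'M[K]_(p, 1)) (v0 : 'rV[K]_1) :
  row_full A ->
  (forall d : 'rV_m, ((v0 + d *m f)%R <= (s0 + vec_mx (d *m A))%R)%MS) ->
  exists x : 'rV_p, forall d, v0 + d *m f = x *m (s0 + vec_mx (d *m A)).
Proof.
move=> A_full rc.
have [d0 d0A] : exists d0, vec_mx (d0 *m A) = - s0.
  have /submxP[d0 d0A] := submx_full (mxvec (- s0)) A_full.
  by exists d0; rewrite -d0A mxvecK.
have v0E : v0 = - (d0 *m f).
  by have := rc d0; rewrite d0A subrr => /submx0null/eqP; rewrite addr_eq0 => /eqP.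
have [B BA] := row_fullP A_full.
(* Both [d0] and [d0 + t] parametrize the zero matrix, so F vanishes at both. *)
have ker_f (t : 'rV_m) : t *m A = 0 -> t *m f = 0.
  move=> tA; have := rc (d0 + t); rewrite !mulmxDl tA addr0 d0A subrr v0E.
  by move/submx0null; rewrite addKr.
have fE : f = A *m (B *m f).
  apply/row_matrixP => i; rewrite !rowE; apply/eqP; rewrite -subr_eq0; apply/eqP.
  rewrite !mulmxA -mulmxBl ker_f // mulmxBl -(mulmxA _ B A) BA mulmx1 subrr //.
pose x := vec_mx (B *m f)^T : 'M[K]_(p, 1).
have tr11 (M : 'M[K]_1) : M = M^T by apply/matrixP => i j; rewrite !ord1 mxE.
have xE (M : 'M_(p, 1)) : mxvec M *m (B *m f) = x^T *m M.
  have := mxvec_dotmul x M^T (1%:M : 'M_1).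
  rewrite trmxK mulmx1 trmx1 mulmx1 /x vec_mxK trmxK => ->.
  by rewrite -/x [LHS]tr11 trmx_mul trmxK.
exists x^T => d; rewrite -xE linearD /= vec_mxK mulmxDl -mulmxA -fE; congr (_ + _).
by rewrite v0E -[s0]opprK -d0A linearN /= vec_mxK mulNmx -mulmxA -fE.
Qed.

Lemma range_compatible_family (K : fieldType) (n p m : nat)
    (A : 'M[K]_(m, p * n)) (f : 'M[K]_(m, n)) (s0 : 'M[K]_(p, n)) (v0 : 'rV[K]_n) :
  more_than_two_elements K -> (p * n < \rank A + n)%N ->
  (forall d : 'rV_m, ((v0 + d *m f)%R <= (s0 + vec_mx (d *m A))%R)%MS) ->
  exists x : 'rV_p, forall d, v0 + d *m f = x *m (s0 + vec_mx (d *m A)).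
Proof.
move=> K2; have [N] := ubnP n; elim: N n A f s0 v0 => // N IH n A f s0 v0 nN codimA rc.
case: n A f s0 v0 nN codimA rc => [|[|n']] A f s0 v0 nN codimA rc.
- by have := rank_leq_col A; lia.
- apply: range_compatible_family_column rc.
  by rewrite /row_full eqn_leq rank_leq_col -ltnS -[X in (_ < X)%N]addn1.
set n := n'.+2 in A f s0 v0 nN codimA rc *; have n1 : (1 < n)%N by [].
pose S (d : 'rV_m) : 'M[K]_(p, n) := s0 + vec_mx (d *m A).
pose F d : 'rV[K]_n := v0 + d *m f.
(* Multiplying by [Q] on the right preserves range-compatibility, so the induction hypothesis
   applies modulo y. *)
have local_mod y : y != 0 -> ~~ tight A y ->
    exists x : 'rV_p, forall d, exists c, F d - x *m S d = c *: y.
  move=> y0 ty; have codimQ := codim_quotient y0 codimA ty.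
  set Q := col_base (cokermx y) in codimQ.
  have SQ d : S d *m Q = s0 *m Q + vec_mx (d *m (A *m lin_mulmxr Q)).
    by rewrite mulmxDl mulmxA -{2}[d *m A]vec_mxK mul_vec_lin /= mxvecK.
  have FQ d : F d *m Q = v0 *m Q + d *m (f *m Q) by rewrite mulmxDl mulmxA.
  have rk_lt : (\rank (cokermx y) < N)%N.
    apply: leq_ltn_trans (_ : n.-1 < N)%N; last by lia.
    rewrite mxrank_coker; have : \rank y != 0%N by rewrite mxrank_eq0.
    by lia.
  have [|x xQ] := IH _ (A *m lin_mulmxr Q) (f *m Q) (s0 *m Q) (v0 *m Q) rk_lt codimQ.
    by move=> d; rewrite -SQ -FQ submxMr //; apply: rc.
  exists x => d; apply/mul_col_base_coker_eq0.
  by rewrite mulmxBl -mulmxA SQ FQ xQ subrr.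
have [z1 [z2 [free t1 t2 t12]]] := exists_pair_not_tight A K2 n1.
have [z1_neq0 [z2_neq0 z12_neq0]] : z1 != 0 /\ z2 != 0 /\ z1 + z2 != 0.
  split; [|split]; apply/eqP => z0.
  - have [] := free 1 0; first by rewrite z0 scaler0 scale0r addr0.
    by move/eqP; rewrite oner_eq0.
  - have [] := free 0 1; first by rewrite z0 scaler0 scale0r addr0.
    by move=> _ /eqP; rewrite oner_eq0.
  - have [] := free 1 1; first by rewrite !scale1r.
    by move/eqP; rewrite oner_eq0.
have [x1 F1] := local_mod _ z1_neq0 t1.
have [x2 F2] := local_mod _ z2_neq0 t2.
have [x3 F3] := local_mod _ z12_neq0 t12.
pose X2 := x2 - x1; pose X3 := x3 - x1.
(* Subtracting the errors of two local approximations cancels [F d]. The signs of [b] and [c] are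
   chosen so that the results read as sums. *)
have coords d : exists a b c, [/\ F d - x1 *m S d = a *: z1,
    F d - x2 *m S d = - (b *: z2), X2 *m S d = a *: z1 + b *: z2 &
    X3 *m S d = a *: z1 + c *: (z1 + z2)].
  have [a Fa] := F1 d; have [b Fb] := F2 d; have [c Fc] := F3 d.
  exists a, (- b), (- c); split; rewrite ?scaleNr ?opprK //.
    by rewrite -Fa -Fb mulmxBl opprB [RHS]addrC addrA subrK.
  by rewrite -Fa -Fc mulmxBl opprB [RHS]addrC addrA subrK.
have no_rank1 d (b0 : K) : b0 != 0 -> X2 *m S d = z1 + b0 *: z2 ->
    (S d <= (z1 + b0 *: z2)%R)%MS -> False.
  move=> b00 X2S Sd; have [a [b [_ [Fa _ X2ab _]]]] := coords d.
  have [a1 _] : a - 1 = 0 /\ b - b0 = 0.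
    by apply: free; rewrite !scalerBl scale1r addrACA -opprD -X2S -X2ab subrr.
  have : (z1 <= (z1 + b0 *: z2)%R)%MS.
    apply: submx_trans Sd; have -> : z1 = F d - x1 *m S d.
      by rewrite Fa -[a](subrK 1) a1 add0r scale1r.
    by rewrite addmx_sub ?eqmx_opp ?submxMl //; apply: rc.
  move=> /sub_rVP[k z1E]; have [k1 kb] : 1 - k = 0 /\ - (k * b0) = 0.
    apply: free; rewrite scalerBl scale1r scaleNr -scalerA -addrA -opprD -scalerDr.
    by rewrite -z1E subrr.
  move/eqP: kb; rewrite oppr_eq0 mulf_eq0 (negbTE b00) orbF => /eqP k0.
  by move/eqP: k1; rewrite k0 subr0 oner_eq0.
(* If x1 = x2, the error [F d - x1 *m S d] lies in both K z1 and K z2, so it vanishes. *)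
have [X20|X20] := eqVneq X2 0.
  exists x1 => d; have [a [b [_ [Fa _ X2S _]]]] := coords d.
  have /free[a0 _] : a *: z1 + b *: z2 = 0 by rewrite -X2S X20 mul0mx.
  by apply/eqP; rewrite -subr_eq0; apply/eqP; rewrite -/(F d) -/(S d) Fa a0 scale0r.
have rkX2 : \rank X2 = 1%N.
  by apply/eqP; rewrite eqn_leq rank_leq_row lt0n mxrank_eq0.
(* When X3 = l X2, comparing coordinates gives l (a - b) = a. So F is local at x1 if l = 0 and at x2
   if l = 1; otherwise b = a (l - 1) / l, and X2 S(d) stays on one line. *)
have [/sub_rVP[l X3E]|X3X2] := boolP (X3 <= X2)%MS.
  have lab d : exists a b, [/\ F d - x1 *m S d = a *: z1,
      F d - x2 *m S d = - (b *: z2), X2 *m S d = a *: z1 + b *: z2 &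
      l * (a - b) = a].
    have [a [b [c [Fa Fb X2S X3S]]]] := coords d; exists a, b; split=> //.
    have [] := free (l * a - (a + c)) (l * b - c).
      move: X3S; rewrite X3E -scalemxAl X2S scalerDr scalerA scalerDr scalerA addrA.
      rewrite -scalerDl => X3S.
      by rewrite !scalerBl addrACA X3S -opprD subrr.
    move=> /eqP; rewrite subr_eq0 => /eqP la /eqP; rewrite subr_eq0 => /eqP lb.
    by rewrite mulrBr la lb addrK.
  have [l0|l0] := eqVneq l 0.
    exists x1 => d; have [a [b [Fa _ _]]] := lab d; rewrite l0 mul0r => a0.
    by apply/eqP; rewrite -subr_eq0; apply/eqP; rewrite -/(F d) -/(S d) Fa -a0 scale0r.
  have [l1|l1] := eqVneq l 1.
    exists x2 => d; have [a [b [_ Fb _]]] := lab d; rewrite l1 mul1r => /eqP.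
    rewrite -subr_eq0 addrAC subrr add0r oppr_eq0 => /eqP b0.
    apply/eqP; rewrite -subr_eq0; apply/eqP.
    by rewrite -/(F d) -/(S d) Fb b0 scale0r oppr0.
  pose b0 := (l - 1) / l; pose z := z1 + b0 *: z2.
  have b00 : b0 != 0 by rewrite mulf_neq0 ?invr_eq0 // subr_eq0.
  have X2_free : row_free X2 by apply/eqP.
  have [X2' X2X2'] := row_freeP X2_free.
  have [] := @family_fills_preimage _ _ _ _ A s0 _ _ _ (mxvec z) X2_free
    codimA _ _ (X2' *m z).
  - by move: (\rank (mxvec z)) (rank_leq_row (mxvec z)) => r; clear; lia.
  - move=> d; rewrite -/(S d); have [a [b [_ _ -> lE]]] := lab d.
    have -> : b = a * b0.
      apply: (mulfI l0); rewrite /b0 mulrCA [l * (_ / l)]mulrC divfK //.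
      by rewrite mulrBr mulr1 -{2}lE; ring.
    by rewrite -scalerA -scalerDr linearZ scalemx_sub.
  - by rewrite mulmxA X2X2' mul1mx.
  move=> d; rewrite -/(S d) => Sd; case: (no_rank1 d b0 b00); rewrite Sd ?submxMl //.
  by rewrite mulmxA X2X2' mul1mx.
have X_free : row_free (col_mx X2 X3).
  rewrite /row_free eqn_leq rank_leq_row -addsmxE ltnNge.
  apply: contra X3X2 => rk_le; apply: submx_trans (addsmxSr X2 X3) _.
  rewrite -(mxrank_leqif_sup (addsmxSl X2 X3)).2 eqn_leq mxrankS ?addsmxSl //=.
  by rewrite [X in (_ <= X)%N]rkX2.
have [X' XX'] := row_freeP X_free.
have [b0 [b00 b01]] := exists_neq01 K2.
(* [g] is chosen so that z1 + g (z1 + z2) = (1 + g) z. Both rows of [M] are then multiples of z,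
   while [M] still has the shape imposed by [coords]. *)
pose z := z1 + b0 *: z2; pose g := b0 / (1 - b0).
have gE : (1 + g) * b0 = g.
  by rewrite /g; field; rewrite subr_eq0 eq_sym.
pose M := col_mx z ((1 + g) *: z).
pose T := col_mx (mxvec (col_mx z1 z1))
  (col_mx (mxvec (col_mx z2 0)) (mxvec (col_mx 0 (z1 + z2)))).
have memT a b c : (mxvec (col_mx (a *: z1 + b *: z2) (a *: z1 + c *: (z1 + z2))) <= T)%MS.
  apply/submxP; exists (row_mx a%:M (row_mx b%:M c%:M)).
  rewrite !mul_row_col !mul_scalar_mx -!linearZ -!linearD /= !scale_col_mx !add_col_mx.
  by rewrite !scaler0 addr0 add0r.
have [] := @family_fills_preimage _ _ _ _ A s0 _ _ _ T X_free codimA _ _ (X' *m M).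
(* [T] has three rows, and 3 + n <= 2 n + 1 because n >= 2. *)
- by move: (\rank T) (rank_leq_row T) n1 => r; clear; lia.
- move=> d; rewrite -/(S d) mul_col_mx; have [a [b [c [_ _ -> ->]]]] := coords d.
  exact: memT.
- rewrite mulmxA XX' mul1mx /M; have := memT 1 b0 g; rewrite !scale1r.
  congr (mxvec (col_mx _ _) <= _)%MS; rewrite !scalerDr scalerA gE scalerDl scale1r.
  by rewrite addrA.
move=> d; rewrite -/(S d) => Sd.
have XS : col_mx X2 X3 *m S d = M by rewrite Sd mulmxA XX' mul1mx.
case: (no_rank1 d b0 b00).
  by move: XS; rewrite mul_col_mx => /eq_col_mx[].
rewrite Sd mulmx_sub // /M col_mx_sub scalemx_sub //.
by rewrite submx_refl.
Qed.

Unset Implicit Arguments.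

Theorem theorem3p2 (K : fieldType) (hK : more_than_two_elements K)
    (U V : vectType K) (S : affspace 'Hom(U, V))
    (hS : codim S <= (\dim {:V})%:Z - 1)
    (F : 'Hom(U, V) -> V)
    (hFaff : affine_map S F) (hFrc : range_compatible S F) :
  local_map S F.
Proof.
case: hFaff => f Ff; set D := aff_dir S in f Ff; set s0 := aff_pt S.
have s0S : s0 \in S by rewrite unfold_in /pred_of_affspace subrr mem0v.
have SD (d : subvs_of D) : s0 + vsval d \in S.
  by rewrite unfold_in /pred_of_affspace addrC addKr subvsP.
set eU := vbasis {:U}; set eV := vbasis {:V}; set e := vbasis {:subvs_of D}.
have eUB : basis_of {:U} eU := vbasisP _.
have eVB : basis_of {:V} eV := vbasisP _.
have eB : basis_of {:subvs_of D} e := vbasisP _.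
pose A := lin1_mx (mxvec \o (mxof eU eV \o (vsval \o vecof e))).
pose B := lin1_mx (rVof eV \o (f \o vecof e)).
have AE d : vec_mx (d *m A) = mxof eU eV (vsval (vecof e d)).
  by rewrite mul_rV_lin1 /= mxvecK.
have BE d : d *m B = rVof eV (f (vecof e d)) by rewrite mul_rV_lin1.
(* Injectivity makes [\rank A] the dimension of the direction, which turns the bound on [codim S]
   into the rank bound for families. *)
have A_free : row_free A.
  apply: inj_row_free => d dA; apply/eqP; rewrite -(vecof_eq0 eB).
  by rewrite -(inj_eq val_inj) /= -(mxof_eq0 eUB eVB) -AE dA linear0.
have FE d : rVof eV (F s0) + d *m B = rVof eV (F (s0 + vsval (vecof e d))).
  by rewrite BE -linearD Ff.
have SE d : mxof eU eV s0 + vec_mx (d *m A) = mxof eU eV (s0 + vsval (vecof e d)).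
  by rewrite AE -linearD.
have [||x xE] := range_compatible_family (A := A) (f := B)
  (s0 := mxof eU eV s0) (v0 := rVof eV (F s0)) hK.
- move: hS; rewrite /codim -/D (eqP A_free).
  rewrite (_ : \dim {:'Hom(U, V)} = (\dim {:U} * \dim {:V})%N); last by rewrite !dimvf.
  rewrite (_ : \dim {:subvs_of D} = \dim D); last by rewrite dimvf.
  move: (\dim D) (\dim {:V}) (\dim {:U}) => a b c; clear; lia.
- move=> d; rewrite FE SE; have /memv_imgP[u _ ->] := hFrc _ (SD (vecof e d)).
  by rewrite (rVof_app _ eUB) submxMl.
exists (vecof eU x) => s sS; apply: (can_inj (rVofK eVB)).
(* The parametrization reaches every s in S: [vsproj] is the identity on the direction, which
   contains [s - s0]. *)
have sE : s = s0 + vsval (vecof e (rVof e (vsproj D (s - s0)))).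
  by rewrite (rVofK eB) vsprojK; [rewrite addrC subrK | exact: sS].
by rewrite {1}sE -FE xE SE -sE mul_mxof.
Qed.
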